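(* For every positive integer $n$, the number $D_P^{(n,n)}$ of period knot $(n,n)$-mosaics satisfies $$\left(D_{P}^{(n,n)}\right)^{\frac{1}{n^2}} \geq 4.$$
   Context: Mosaic tiles: there are eleven tiles $T_0,\dots,T_{10}$ (unit squares with curves drawn on them). A connection point of a tile is the midpoint of an edge (left, right, top, bottom) of the tile that is an endpoint of a curve drawn on the tile. The sets of edges carrying connection points are as follows: $T_0$: none; $T_1$: left, bottom; $T_2$: right, bottom; $T_3$: right, top; $T_4$: left, top; $T_5$: left, right; $T_6$: top, bottom; $T_7,T_8,T_9,T_{10}$: all four edges. Thus each two-element set of edges occurs for exactly one tile, the empty set for exactly one tile, and the full set for exactly four (distinct) tiles. For positive integers $m,n$, an $(m,n)$-mosaic is an $m\times n$ matrix $M=(M_{ij})$ of mosaic tiles (row 1 at the top, column 1 at the left). It is suitably connected if any two tiles immediately next to each other in the same row or the same column either both have or both do not have a connection point on their common edge. It is suitably $\partial$-connected if for each row, the leftmost tile has a connection point on its left edge if and only if the rightmost tile has one on its right edge, and for each column, the topmost tile has a connection point on its top edge if and only if the bottommost tile has one on its bottom edge (when $n=1$ or $m=1$ the two tiles in question coincide). A period knot $(m,n)$-mosaic is a suitably connected and suitably $\partial$-connected $(m,n)$-mosaic. $D_P^{(m,n)}$ denotes the number of period knot $(m,n)$-mosaics. *)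

(* Defs.v *)
From HB Require Import structures.
From mathcomp Require Import all_boot all_order all_algebra.

Set Implicit Arguments.
Unset Strict Implicit.
Unset Printing Implicit Defensive.

Inductive side := Left | Right | Top | Bottom.

Definition nat_of_side (e : side) : nat :=
  match e with Left => 0 | Right => 1 | Top => 2 | Bottom => 3 end.

Definition side_of_nat (k : nat) : side :=
  match k with 0 => Left | 1 => Right | 2 => Top | _ => Bottom end.

Lemma nat_of_sideK : cancel nat_of_side side_of_nat.
Proof. by case. Qed.

HB.instance Definition _ := Countable.copy side (can_type nat_of_sideK).

Inductive tile := T0 | T1 | T2 | T3 | T4 | T5 | T6 | T7 | T8 | T9 | T10.

Definition all_tiles : seq tile :=
  [:: T0; T1; T2; T3; T4; T5; T6; T7; T8; T9; T10].

Definition nat_of_tile (t : tile) : nat :=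
  match t with
  | T0 => 0 | T1 => 1 | T2 => 2 | T3 => 3 | T4 => 4 | T5 => 5
  | T6 => 6 | T7 => 7 | T8 => 8 | T9 => 9 | T10 => 10
  end.

Lemma nat_of_tileK : cancel nat_of_tile (nth T0 all_tiles).
Proof. by case. Qed.

HB.instance Definition _ := Countable.copy tile (can_type nat_of_tileK).

Lemma all_tilesP : Finite.axiom all_tiles.
Proof. by case. Qed.

HB.instance Definition _ := isFinite.Build tile all_tilesP.

(* The edges of a tile that carry a connection point.  The tiles T7, ..., T10
   carry different curves with the same end points; only their number matters
   for counting mosaics, so the curves themselves are not represented. *)
Definition connection_points (t : tile) : seq side :=
  match t with
  | T0 => [::]
  | T1 => [:: Left; Bottom]
  | T2 => [:: Right; Bottom]
  | T3 => [:: Right; Top]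
  | T4 => [:: Left; Top]
  | T5 => [:: Left; Right]
  | T6 => [:: Top; Bottom]
  | T7 | T8 | T9 | T10 => [:: Left; Right; Top; Bottom]
  end.

Definition has_conn (e : side) (t : tile) : bool := e \in connection_points t.

(* Row index 0 is the top row and column index 0 is the leftmost column. *)
Definition mosaic (m n : nat) := 'M[tile]_(m, n).

Definition suitably_connected (m n : nat) (M : mosaic m n) : bool :=
  [forall i : 'I_m, forall j : 'I_n, forall j' : 'I_n,
     (j' == j.+1 :> nat) ==>
       (has_conn Right (M i j) == has_conn Left (M i j'))]
  && [forall i : 'I_m, forall i' : 'I_m, forall j : 'I_n,
     (i' == i.+1 :> nat) ==>
       (has_conn Bottom (M i j) == has_conn Top (M i' j))].

(* The first and last index are characterized by their values, so that the
   definition makes sense for all m and n without casts. *)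
Definition suitably_boundary_connected (m n : nat) (M : mosaic m n) : bool :=
  [forall i : 'I_m, forall j : 'I_n, forall j' : 'I_n,
     (j == 0 :> nat) && (j'.+1 == n) ==>
       (has_conn Left (M i j) == has_conn Right (M i j'))]
  && [forall i : 'I_m, forall i' : 'I_m, forall j : 'I_n,
     (i == 0 :> nat) && (i'.+1 == m) ==>
       (has_conn Top (M i j) == has_conn Bottom (M i' j))].

Definition period_knot_mosaic (m n : nat) (M : mosaic m n) : bool :=
  suitably_connected M && suitably_boundary_connected M.

(* The number of period knot (m,n)-mosaics, written D_P^(m,n). *)
Definition DP (m n : nat) : nat :=
  #|[set M : 'M[tile]_(m, n) | period_knot_mosaic M]|.

(* Main.v *)
Require Import Defs.
From mathcomp Require Import all_boot all_order all_algebra.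
From mathcomp Require Import reals exp.

Import Order.TTheory GRing.Theory Num.Theory.
Local Open Scope ring_scope.

(** When every edge of every tile carries a connection point, all the
connection and boundary conditions hold at once, whatever the curves are. Four
tiles have this property, so the [m * n] cells can be filled with them freely:
this gives [4 ^ (m * n)] period knot mosaics ([leq_4_exp_DP]). The theorem is
the case of a square, after taking the root of order [n ^ 2]. *)

Lemma inj_map_mx (aT rT : Type) (f : aT -> rT) m n :
  injective f -> injective (map_mx f : 'M_(m, n) -> 'M_(m, n)).
Proof.
move=> f_inj A B /matrixP eq_fAB; apply/matrixP=> i j.
by apply: f_inj; have := eq_fAB i j; rewrite !mxE.
Qed.

Definition four_point_tile (k : 'I_4) : tile := nth T7 [:: T7; T8; T9; T10] k.

Lemma four_point_tile_inj : injective four_point_tile.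
Proof.
move=> k l /eqP; rewrite /four_point_tile nth_uniq ?ltn_ord // => /eqP.
exact: val_inj.
Qed.

Lemma has_conn_four_point_tile e k : has_conn e (four_point_tile k).
Proof. by case: k => [[|[|[|[|k]]]] lt_k4] //; case: e. Qed.

Lemma period_knot_mosaic_four_point_tile m n (A : 'M['I_4]_(m, n)) :
  period_knot_mosaic (map_mx four_point_tile A).
Proof.
by apply/andP; split; apply/andP; split; do 3!apply/forallP => ?;
   rewrite !mxE !has_conn_four_point_tile implybT.
Qed.

Lemma leq_4_exp_DP m n : (4 ^ (m * n) <= DP m n)%N.
Proof.
rewrite -[4%N]card_ord -card_mx.
rewrite -(card_imset predT (@inj_map_mx _ _ _ m n four_point_tile_inj)).
apply/subset_leq_card/subsetP => _ /imsetP[A _ ->].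
by rewrite inE period_knot_mosaic_four_point_tile.
Qed.

Theorem mainTheorem5 (R : realType) (n : nat) (hn : (0 < n)%N) :
  4 <= ((DP n n)%:R : R) `^ (1 / (n ^ 2)%N%:R).
Proof.
have n2_neq0 : (n ^ 2)%N%:R != 0 :> R by rewrite pnatr_eq0 -lt0n expn_gt0 hn.
have -> : 4 = ((4 ^ (n ^ 2))%N%:R : R) `^ (1 / (n ^ 2)%N%:R).
  by rewrite natrX -powR_mulrn ?ler0n // -powRrM div1r mulfV // powRr1 ?ler0n.
apply: ge0_ler_powR; rewrite ?nnegrE ?divr_ge0 ?ler0n ?ler01 //.
by rewrite ler_nat -mulnn leq_4_exp_DP.
Qed.
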